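(* The Pell-Narayana length of the polyhedral group $(2,2,2)=\langle x,y : x^2=y^2=(xy)^2=e\rangle$, for the generating pair $(x,y)$, is $3$.
   Context: For integers $\ell,m,n>1$, the polyhedral group $(\ell,m,n)$ is defined by the presentation $\langle x,y : x^\ell=y^m=(xy)^n=e\rangle$ (equivalently $\langle x,y,z : x^\ell=y^m=z^n=xyz=e\rangle$). For a finite group $G$ generated by a pair $(x,y)$, the Pell-Narayana orbit of $G$ for $(x,y)$ is the sequence $(s_n)_{n\ge 0}$ in $G$ given by $s_0=x$, $s_1=y$, $s_2=y^2$, and $s_n=s_{n-3}(s_{n-1})^2$ for $n\ge 3$. The Pell-Narayana length of $G$ for $(x,y)$ is the period of this orbit, i.e. the least integer $k\ge 1$ such that $s_{n+k}=s_n$ for all $n\ge 0$. *)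

(* Defs.v *)
From HB Require Import structures.
From mathcomp Require Import all_boot boolp.

Set Implicit Arguments.
Unset Strict Implicit.
Unset Printing Implicit Defensive.

Local Open Scope group_scope.
Local Open Scope quotient_scope.

(* The group <X | R> given by generators and relators.  MathComp's Grp
   presentations only compare finite groups and do not name the images of the
   generators, so the presented group is built here as a groupType. *)
Section Presentation.
Variable X : choiceType.

(* The letter (a, false) stands for a, and (a, true) for its inverse. *)
Definition letter := (X * bool)%type.
Definition word := seq letter.

Definition inv_letter (a : letter) : letter := (a.1, ~~ a.2).
Definition inv_word (u : word) : word := rev (map inv_letter u).

Variable R : seq word.

Inductive pres_eq : word -> word -> Prop :=
| PresRefl u : pres_eq u u
| PresSym u v : pres_eq u v -> pres_eq v u
| PresTrans u v w : pres_eq u v -> pres_eq v w -> pres_eq u w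
| PresCancel u a v : pres_eq (u ++ a :: inv_letter a :: v) (u ++ v)
| PresRel u r v : r \in R -> pres_eq (u ++ r ++ v) (u ++ v).

Definition pres_eqb (u v : word) : bool := `[< pres_eq u v >].

Lemma pres_eqb_refl : reflexive pres_eqb.
Proof. by move=> u; apply/asboolP/PresRefl. Qed.

Lemma pres_eqb_sym : symmetric pres_eqb.
Proof.
by move=> u v; apply/idP/idP => /asboolP uv; apply/asboolP/PresSym.
Qed.

Lemma pres_eqb_trans : transitive pres_eqb.
Proof.
by move=> v u w /asboolP uv /asboolP vw; apply/asboolP/(PresTrans uv).
Qed.

Canonical pres_equiv : equiv_rel word :=
  EquivRel pres_eqb pres_eqb_refl pres_eqb_sym pres_eqb_trans.

Definition presented_group := {eq_quot pres_equiv}.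

HB.instance Definition _ := Choice.on presented_group.
HB.instance Definition _ := EqQuotient.on presented_group.

Definition pres_class (u : word) : presented_group := \pi_presented_group u.

Lemma pres_classP u v : pres_class u = pres_class v <-> pres_eq u v.
Proof.
split=> [/eqP|uv]; first by rewrite piE => /asboolP.
by apply/eqP; rewrite piE; apply/asboolP.
Qed.

Lemma pres_eq_cat2 u u' v v' :
  pres_eq u u' -> pres_eq v v' -> pres_eq (u ++ v) (u' ++ v').
Proof.
move=> uu' vv'; apply: (@PresTrans _ (u' ++ v)).
  elim: uu' => {u u'} [u|u w _ IH|u w t _ IH1 _ IH2|u a w|u r w rR].
  - exact: PresRefl.
  - exact: PresSym.
  - exact: PresTrans IH1 IH2.
  - by rewrite -!catA /=; apply: PresCancel.
  - by rewrite -!catA; apply: PresRel.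
elim: vv' => {v v'} [v|v w _ IH|v w t _ IH1 _ IH2|v a w|v r w rR].
- exact: PresRefl.
- exact: PresSym.
- exact: PresTrans IH1 IH2.
- by rewrite !catA; apply: PresCancel.
- by rewrite (catA u' v w) (catA u' v (r ++ w)); apply: PresRel.
Qed.

Lemma inv_letterK : involutive inv_letter.
Proof. by case=> x b; rewrite /inv_letter /= negbK. Qed.

Lemma inv_wordK : involutive inv_word.
Proof.
by move=> u; rewrite /inv_word map_rev revK -map_comp map_id_in // => a _ /=;
  rewrite inv_letterK.
Qed.

Lemma inv_word_cons a u : inv_word (a :: u) = inv_word u ++ [:: inv_letter a].
Proof. by rewrite /inv_word /= rev_cons cats1. Qed.

Lemma pres_eq_mulV u : pres_eq (u ++ inv_word u) [::].
Proof.
elim: u => [|a u IH]; first exact: PresRefl.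
rewrite inv_word_cons /= catA -cat1s.
apply: PresTrans (PresCancel [::] a [::]).
by apply: (@pres_eq_cat2 [:: a] [:: a] _ [:: inv_letter a]);
  [exact: PresRefl | apply: (pres_eq_cat2 IH (PresRefl _))].
Qed.

Lemma pres_eq_Vmul u : pres_eq (inv_word u ++ u) [::].
Proof. by rewrite -{2}(inv_wordK u); apply: pres_eq_mulV. Qed.

Lemma pres_eq_inv u v : pres_eq u v -> pres_eq (inv_word u) (inv_word v).
Proof.
move=> uv; apply: (@PresTrans _ (inv_word u ++ (v ++ inv_word v))).
  rewrite -[X in pres_eq X _]cats0; apply: pres_eq_cat2 (PresRefl _) _.
  exact/PresSym/pres_eq_mulV.
rewrite catA -[X in pres_eq _ X]cat0s; apply: pres_eq_cat2 (PresRefl _).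
apply: PresTrans (pres_eq_Vmul u).
exact: pres_eq_cat2 (PresRefl _) (PresSym uv).
Qed.

Definition pres_one : presented_group := pres_class [::].
Definition pres_mul (g h : presented_group) : presented_group :=
  pres_class (repr g ++ repr h).
Definition pres_inv (g : presented_group) : presented_group :=
  pres_class (inv_word (repr g)).

Lemma repr_pres_class u : pres_eq (repr (pres_class u)) u.
Proof. by apply/pres_classP; apply: reprK. Qed.

Lemma pres_class_repr g : pres_class (repr g) = g.
Proof. exact: reprK. Qed.

Lemma pres_mulE u v :
  pres_mul (pres_class u) (pres_class v) = pres_class (u ++ v).
Proof. by apply/pres_classP/pres_eq_cat2; apply: repr_pres_class. Qed.

Lemma pres_invE u : pres_inv (pres_class u) = pres_class (inv_word u).
Proof. by apply/pres_classP/pres_eq_inv/repr_pres_class. Qed.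

Lemma pres_mulA : associative pres_mul.
Proof.
move=> g h k; rewrite -(pres_class_repr g) -(pres_class_repr h).
by rewrite -(pres_class_repr k) !pres_mulE catA.
Qed.

Lemma pres_mul1 : left_id pres_one pres_mul.
Proof. by move=> g; rewrite -(pres_class_repr g) pres_mulE. Qed.

Lemma pres_mulr1 : right_id pres_one pres_mul.
Proof. by move=> g; rewrite -(pres_class_repr g) pres_mulE cats0. Qed.

Lemma pres_mulV : left_inverse pres_one pres_inv pres_mul.
Proof.
move=> g; rewrite -(pres_class_repr g) pres_invE pres_mulE.
exact/pres_classP/pres_eq_Vmul.
Qed.

Lemma pres_mulrV : right_inverse pres_one pres_inv pres_mul.
Proof.
move=> g; rewrite -(pres_class_repr g) pres_invE pres_mulE.
exact/pres_classP/pres_eq_mulV.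
Qed.

HB.instance Definition _ := isGroup.Build presented_group
  pres_mulA pres_mul1 pres_mulr1 pres_mulV pres_mulrV.

Definition pres_gen (a : X) : presented_group := pres_class [:: (a, false)].

Lemma pres_classM u v : pres_class (u ++ v) = pres_class u * pres_class v.
Proof. by rewrite -pres_mulE. Qed.

Lemma pres_class_rel r : r \in R -> pres_class r = 1.
Proof.
by move=> rR; apply/pres_classP; have := PresRel [::] [::] rR; rewrite cats0.
Qed.

Section Universal.
Variables (H : groupType) (f : X -> H).

Definition eval_letter (a : letter) : H := if a.2 then (f a.1)^-1 else f a.1.
Definition eval_word (u : word) : H := \prod_(a <- u) eval_letter a.

Lemma eval_word_pres_eq : (forall r, r \in R -> eval_word r = 1) ->
  forall u v, pres_eq u v -> eval_word u = eval_word v.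
Proof.
move=> fR u v; rewrite /eval_word.
elim=> {u v} // [u v w _ -> //|u [a b] v|u r v /fR].
  rewrite !big_cat !big_cons /= /eval_letter /=.
  by case: b; rewrite /= ?mulKg ?mulVKg.
by rewrite /eval_word !big_cat /= => ->; rewrite mul1g.
Qed.

Lemma pres_universal : (forall r, r \in R -> eval_word r = 1) ->
  exists! phi : presented_group -> H,
    {morph phi : g h / g * h} /\ forall a, phi (pres_gen a) = f a.
Proof.
move=> fR; have fE := eval_word_pres_eq fR.
exists (fun g => eval_word (repr g)); split.
  split=> [g h|a].
    rewrite -[RHS]big_cat; apply: fE; exact: repr_pres_class.
  by rewrite (fE _ _ (repr_pres_class _)) /eval_word big_seq1.
move=> phi [phiM phiX]; apply/funext => g.
have phi1 : phi 1 = 1 by apply: (mulgI (phi 1)); rewrite -phiM !mulg1.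
rewrite -[in RHS](pres_class_repr g); elim: (repr g) => [|[a b] u IH].
  by rewrite /eval_word big_nil phi1.
rewrite /eval_word big_cons -[\prod_(_ <- u) _]/(eval_word u) IH.
rewrite -(cat1s _ u) pres_classM phiM; congr (_ * _).
rewrite /eval_letter; case: b => /=; last exact/esym/phiX.
apply: (mulgI (f a)); rewrite mulgV -phiX -phiM -pres_classM -phi1.
congr phi; apply/esym/pres_classP; exact: (PresCancel [::] (a, false) [::]).
Qed.

End Universal.
End Presentation.

(* (l, m, n) = <x, y : x^l = y^m = (xy)^n = e>; the generators x and y are
   indexed by false and true. *)
Definition polyhedral_relators (l m n : nat) : seq (word bool) :=
  let x := (false, false) in let y := (true, false) in
  [:: nseq l x; nseq m y; flatten (nseq n [:: x; y])].

Definition polyhedral (l m n : nat) : groupType :=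
  presented_group (polyhedral_relators l m n).

Definition polyhedral_x l m n : polyhedral l m n := pres_gen _ false.
Definition polyhedral_y l m n : polyhedral l m n := pres_gen _ true.

Fixpoint pell_narayana_orbit (G : groupType) (x y : G) (n : nat) : G :=
  match n with
  | 0 => x
  | 1 => y
  | 2 => y ^+ 2
  | ((k.+1 as k1).+1 as k2).+1 =>
      pell_narayana_orbit x y k * pell_narayana_orbit x y k2 ^+ 2
  end.

Definition is_period (T : Type) (s : nat -> T) (k : nat) : Prop :=
  0 < k /\ forall n, s (n + k) = s n.

Definition is_pell_narayana_length (G : groupType) (x y : G) (k : nat) : Prop :=
  is_period (pell_narayana_orbit x y) k /\
  forall j, is_period (pell_narayana_orbit x y) j -> k <= j.

(* Main.v *)
(** Both generators have order dividing 2, so every term of the orbit squares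
    to 1 and the recursion collapses to s_n = s_(n-3).  No shorter period occurs
    because x is neither y nor 1, as seen on the homomorphism to the group of
    order 2 that kills y but not x. *)
Require Import Defs.
From mathcomp Require Import all_boot.
From mathcomp Require Import fingroup perm.

Local Open Scope group_scope.

Lemma pres_genX (X : choiceType) (R : seq (word X)) (a : X) k :
  pres_gen R a ^+ k = pres_class R (nseq k (a, false)).
Proof. by elim: k => [|k IH] //; rewrite expgS IH -pres_classM. Qed.

Lemma polyhedral_xX l m n : polyhedral_x l m n ^+ l = 1.
Proof. by rewrite pres_genX pres_class_rel // mem_head. Qed.

Lemma polyhedral_yX l m n : polyhedral_y l m n ^+ m = 1.
Proof. by rewrite pres_genX pres_class_rel // !inE eqxx orbT. Qed.

(** The recursion reaches back three terms, so the induction carries three consecutive squares; once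
    the last is trivial, the next term equals the first of the three. *)
Lemma pell_narayana_orbit_sqr (G : groupType) (x y : G) n :
  x ^+ 2 = 1 -> y ^+ 2 = 1 -> pell_narayana_orbit x y n ^+ 2 = 1.
Proof.
move=> x2 y2; suff [] : [/\ pell_narayana_orbit x y n ^+ 2 = 1,
  pell_narayana_orbit x y n.+1 ^+ 2 = 1
  & pell_narayana_orbit x y n.+2 ^+ 2 = 1] by [].
elim: n => [|n [s0 s1 s2]]; first by split; rewrite //= y2 expg1n.
split=> //.
rewrite -[pell_narayana_orbit x y n.+3]/(pell_narayana_orbit x y n *
  pell_narayana_orbit x y n.+2 ^+ 2).
by rewrite s2 mulg1.
Qed.

Lemma pell_narayana_orbit_period3 (G : groupType) (x y : G) :
  x ^+ 2 = 1 -> y ^+ 2 = 1 -> is_period (pell_narayana_orbit x y) 3.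
Proof.
move=> x2 y2; split=> // n; rewrite addn3.
rewrite -[LHS]/(pell_narayana_orbit x y n * pell_narayana_orbit x y n.+2 ^+ 2).
by rewrite pell_narayana_orbit_sqr // mulg1.
Qed.

Lemma polyhedral222_x_neq :
  polyhedral_x 2 2 2 <> polyhedral_y 2 2 2 /\ polyhedral_x 2 2 2 <> 1.
Proof.
pose t : {perm bool} := tperm false true.
pose f b : {perm bool} := if b then 1 else t.
have t1 : t <> 1 by move/permP/(_ false); rewrite tpermL perm1.
(* Each relator contains [x] an even number of times, and [t] is an involution. *)
have fR r : r \in polyhedral_relators 2 2 2 -> eval_word f r = 1.
  rewrite !inE => /or3P[] /eqP-> ;
    by rewrite /eval_word !big_cons big_nil /eval_letter /= ?mul1g ?mulg1 ?tperm2.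
(* Under [f], either equality would force [t = 1]. *)
split=> /pres_classP/(eval_word_pres_eq fR);
  by rewrite /eval_word ?big_seq1 ?big_nil.
Qed.

Theorem theorem18 :
  is_pell_narayana_length (polyhedral_x 2 2 2) (polyhedral_y 2 2 2) 3.
Proof.
have [xNy xN1] := polyhedral222_x_neq.
have y2 := polyhedral_yX 2 2 2.
split; first exact: pell_narayana_orbit_period3 (polyhedral_xX 2 2 2) y2.
(* At index 0, period 1 would give [y = x], and period 2 would give [y ^+ 2 = x], hence [x = 1]. *)
case=> [|[|[|//]]] [// _ /(_ 0)] /= E; first by case: xNy.
by case: xN1; rewrite -E.
Qed.
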